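(* Let $p$ be a prime with $p\equiv 3\bmod 4$, let $t\ge1$, and let $a$ be an integer not divisible by $p$ with $\left(\frac{a}{p}\right)=1$. Then $$c_2(a;p^t)=1-2\sum_{i=0}^{\lfloor t/2\rfloor-1}\frac{1}{p^{2i+1}}+\frac{2}{\phi(p^t)}.$$
   Context: For $n\ge2$ and $a$ coprime to $n$, $H_2(a;n)=\{(x,y)\in\mathbb{Z}^2: xy\equiv a \bmod n,\ 1\le x,y<n\}$, $\bar{S}_2(a;n)=\{x+y \bmod n:(x,y)\in H_2(a;n)\}$, $\bar{D}_2(a;n)=\{x-y \bmod n:(x,y)\in H_2(a;n)\}$, and $c_2(a;n)=\#\bar{S}_2(a;n)/\#\bar{D}_2(a;n)$. $\phi$ is Euler's totient function, $\left(\frac{a}{p}\right)$ the Legendre symbol, and an empty sum is $0$. *)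

(* Defs.v *)
From mathcomp Require Import all_boot all_order all_algebra.

Set Implicit Arguments.
Unset Strict Implicit.
Unset Printing Implicit Defensive.

Import Order.TTheory GRing.Theory Num.Theory.
Local Open Scope ring_scope.

Definition H2 (a : int) (n : nat) : {set 'I_n * 'I_n} :=
  [set xy : 'I_n * 'I_n | [&& (1 <= xy.1)%N, (1 <= xy.2)%N
     & ((xy.1 : nat)%:Z * (xy.2 : nat)%:Z == a %[mod n%:Z])%Z]].

(* The next two definitions are meaningful for n >= 2 only, as 'Z_0 and 'Z_1
   both denote the ring of integers modulo 2. *)
Definition Sbar2 (a : int) (n : nat) : {set 'Z_n} :=
  [set ((xy.1 : nat)%:Z + (xy.2 : nat)%:Z)%:~R | xy : 'I_n * 'I_n in H2 a n].

Definition Dbar2 (a : int) (n : nat) : {set 'Z_n} :=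
  [set ((xy.1 : nat)%:Z - (xy.2 : nat)%:Z)%:~R | xy : 'I_n * 'I_n in H2 a n].

Definition c2 (a : int) (n : nat) : rat := #|Sbar2 a n|%:R / #|Dbar2 a n|%:R.

Definition legendre (a : int) (p : nat) : int :=
  if (p%:Z %| a)%Z then 0
  else if [exists x : 'I_p, ((x : nat)%:Z ^+ 2 == a %[mod p%:Z])%Z] then 1
  else -1.

(* Main.v *)
Require Import Defs.
From mathcomp Require Import all_boot all_order all_algebra.
From mathcomp Require Import cyclic ring zify.

(* Work in R = Z/p^t. The two sets are the images of the units of R under
   x |-> x + a/x and x |-> x - a/x, and the size of an image is the sum of the
   inverse fibre sizes. The fibre of x |-> x + a/x through x is in bijection with
   the roots w of w (w + c) = 0, where c = x - a/x; their number depends only on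
   the p-adic valuation of c: it is 2 p^k if c has valuation k < t/2, and
   p^(floor (t/2)) if c is divisible by p^(ceil (t/2)).
   Since p = 3 mod 4, totient (p^t) = 2 m with m odd; this makes a = b^2 a square
   in R, and makes x^2 + b^2 a unit for all units x. Hence every fibre of the
   difference map has two elements, while for the sum map
   x (x - a/x) = (x - b) (x + b) shows that p^k divides x - a/x for exactly
   2 p^(t-k) units x, for 1 <= k <= t. Abel summation over k gives the formula. *)

Set Implicit Arguments.
Unset Strict Implicit.
Unset Printing Implicit Defensive.

Import Order.TTheory GRing.Theory Num.Theory.
Local Open Scope ring_scope.

(** * Divisibility by a divisor of [n], read off canonical representatives modulo [n] *)

Section ZpDivisibility.

Variables (n : nat) (n_gt1 : (1 < n)%N).
Implicit Types (x y z : 'Z_n) (d : nat).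

Lemma dvdn_natZp d m : (d %| n)%N -> (d %| (m%:R : 'Z_n))%N = (d %| m)%N.
Proof. by move=> dn; rewrite val_Zp_nat // /dvdn modn_dvdm. Qed.

Lemma dvdn_intZp d (z : int) :
  (d %| n)%N -> (d %| (z%:~R : 'Z_n))%N = (d%:Z %| z)%Z.
Proof.
move=> dn; have n0 : n%:Z != 0 by lia.
rewrite {1}(divz_eq z n%:Z) intrD intrM -pmulrn pchar_Zp // mulr0 add0r.
have : (0 <= z %% n%:Z)%Z by rewrite modz_ge0.
case E : (z %% n%:Z)%Z => [r|//] _.
rewrite -pmulrn dvdn_natZp //.
by rewrite (divz_eq z n%:Z) E [RHS]rpredDl // dvdz_mull.
Qed.

Lemma dvdnZpD d x y :
  (d %| n)%N -> (d %| x)%N -> (d %| y)%N -> (d %| (x + y)%R)%N.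
Proof.
by move=> dn dx dy; rewrite -(natr_Zp x) -(natr_Zp y) -natrD dvdn_natZp ?dvdn_add.
Qed.

Lemma dvdnZpM d1 d2 x y : (d1 * d2 %| n)%N ->
  (d1 %| x)%N -> (d2 %| y)%N -> (d1 * d2 %| (x * y)%R)%N.
Proof.
move=> dn dx dy; rewrite -(natr_Zp x) -(natr_Zp y) -natrM dvdn_natZp //.
exact: dvdn_mul.
Qed.

Lemma dvdnZpMl d x y : (d %| n)%N -> (d %| x)%N -> (d %| (y * x)%R)%N.
Proof. by move=> dn dx; rewrite -[d]mul1n; apply: dvdnZpM; rewrite ?mul1n. Qed.

Lemma dvdnZpN d x : (d %| n)%N -> (d %| (- x)%R)%N = (d %| x)%N.
Proof.
move=> dn; have H z : (d %| z)%N -> (d %| (- z)%R)%N.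
  by rewrite -mulN1r; apply: dvdnZpMl.
by apply/idP/idP => /H //; rewrite opprK.
Qed.

Lemma dvdnZpDr d x y :
  (d %| n)%N -> (d %| x)%N -> (d %| (x + y)%R)%N = (d %| y)%N.
Proof.
move=> dn dx; apply/idP/idP => [dxy|]; last exact: dvdnZpD.
by rewrite -[y](addKr x) dvdnZpD ?dvdnZpN.
Qed.

Lemma dvdnZpMunit d x y : (d %| n)%N -> x \is a GRing.unit ->
  (d %| (x * y)%R)%N = (d %| y)%N.
Proof.
move=> dn Ux; apply/idP/idP; last exact: dvdnZpMl.
by move=> /(dvdnZpMl x^-1 dn); rewrite mulKr.
Qed.

Lemma Zp_eq0_dvdn x : (x == 0) = (n %| x)%N.
Proof. by rewrite -{1}(natr_Zp x) -val_eqE /= val_Zp_nat. Qed.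

Lemma unitZp_coprime x : (x \is a GRing.unit) = coprime n x.
Proof. by rewrite -{1}(natr_Zp x) unitZpE. Qed.

Lemma unitZp_expr_totient x : x \is a GRing.unit -> x ^+ totient n = 1.
Proof.
rewrite unitZp_coprime coprime_sym => /Euler_exp_totient E.
apply: val_inj; rewrite -(natr_Zp x) -natrX.
exact: etrans (val_Zp_nat n_gt1 _) (etrans E (esym (val_Zp_nat n_gt1 1))).
Qed.

Lemma card_Zp_multiples d : (0 < d)%N -> (d %| n)%N ->
  #|[set x : 'Z_n | d %| x]%N| = (n %/ d)%N.
Proof.
move=> d_gt0 dn.
have nd : (n = n %/ d * d)%N by rewrite divnK.
pose g (i : 'I_(n %/ d)) : 'Z_n := (i * d)%:R.
have valg i : g i = (i * d)%N :> nat.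
  by rewrite val_Zp_nat // modn_small // {2}nd ltn_pmul2r.
rewrite -[RHS]card_ord -(card_imset (f := g)).
  apply: eq_card => x; rewrite inE; apply/idP/imsetP => [/dvdnP[q xq]|[i _ ->]].
    have xn : (x < n)%N by rewrite -[ltnRHS]Zp_cast.
    have qn : (q < n %/ d)%N by rewrite -(ltn_pmul2r d_gt0) -xq -nd.
    by exists (Ordinal qn) => //; apply: val_inj; rewrite /= valg.
  by rewrite valg dvdn_mull.
by move=> i j /(congr1 val) /= /eqP; rewrite !valg eqn_pmul2r // => /eqP /val_inj.
Qed.

Lemma card_Zp_coset d (c : 'Z_n) : (0 < d)%N -> (d %| n)%N ->
  #|[set x : 'Z_n | d %| (x + c)%R]%N| = (n %/ d)%N.
Proof.
move=> d_gt0 dn; rewrite -card_Zp_multiples //.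
rewrite -[RHS](card_preimset (f := fun x : 'Z_n => x + c) _ (@addIr _ c)).
by apply: eq_card => x; rewrite !inE.
Qed.

End ZpDivisibility.

(** * Image sizes from fibres, and two finite sums *)

Lemma card_imset_fibre (F : numFieldType) (aT rT : finType) (A : {set aT})
    (f : aT -> rT) :
  #|f @: A|%:R = \sum_(x in A) #|[set y in A | f y == f x]|%:R^-1 :> F.
Proof.
rewrite (partition_big_imset f) /= -sum1_card natr_sum; apply: eq_bigr => z.
case/imsetP => x Ax ->.
(* All points of one fibre carry the same weight, the inverse of its size, so each fibre contributes
   1. *)
rewrite (eq_bigr (fun=> #|[set y in A | f y == f x]|%:R^-1)); last first.
  by move=> y /andP[_ /eqP ->].
rewrite (eq_bigl [in [set y in A | f y == f x]]) => [|y]; last by rewrite !inE.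
rewrite sumr_const -[RHS]mulr_natr.
rewrite mulVf // pnatr_eq0 -lt0n card_gt0; apply/set0Pn.
by exists x; rewrite inE Ax eqxx.
Qed.

Lemma sumr_indicator_lt (R : pzSemiRingType) (k m : nat) (d : nat -> R) : (k <= m)%N ->
  \sum_(i < m) (i < k)%N%:R * d i = \sum_(i < k) d i.
Proof.
move=> km; rewrite (big_ord_widen m d km) [RHS]big_mkcond; apply: eq_bigr => i _.
by case: ifP => _; rewrite ?mul1r ?mul0r.
Qed.

Lemma sumr_geom_telescope (F : fieldType) (q : F) k :
  \sum_(i < k) (q ^+ i.+1 - q ^+ i) / 2 = (q ^+ k - 1) / 2.
Proof.
rewrite -mulr_suml; congr (_ / 2).
by rewrite -(big_mkord xpredT (fun i => q ^+ i.+1 - q ^+ i)) telescope_sumr.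
Qed.

(** * The sum and difference sets as images of the unit group *)

Definition unitsZ (n : nat) : {set 'Z_n} := [set x | x \is a GRing.unit].
(** Negating [a] turns this into x |-> x - a/x, so one count serves both sets. *)
Definition hyper_sum (n : nat) (a x : 'Z_n) : 'Z_n := x + a / x.

(** As [a] is a unit, both factors of a solution are units. Units are nonzero, so the bounds
    [1 <= x, y] hold automatically. *)
Lemma H2P (a : int) (m : nat) (x y : 'I_m.+2) : coprimez m.+2 a ->
  reflect ((x : 'Z_m.+2) \is a GRing.unit /\ (y : 'Z_m.+2) = a%:~R / (x : 'Z_m.+2))
    ((x, y) \in H2 a m.+2).
Proof.
move=> co_a.
have Ua : (a%:~R : 'Z_m.+2) \is a GRing.unit.
  have /coprimezP[[u v] /= uv1] := co_a; apply/unitrPr; exists v%:~R.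
  have := congr1 (fun z : int => z%:~R : 'Z_m.+2) uv1.
  by rewrite intrD !intrM -pmulrn pchar_Zp // mulr0 add0r mulrC.
have memE : ((x : nat)%:Z * (y : nat)%:Z == a %[mod m.+2%:Z])%Z
    = ((x : 'Z_m.+2) * y == a%:~R).
  rewrite eqz_mod_dvd -(@dvdn_intZp m.+2) // -Zp_eq0_dvdn // intrB intrM -!pmulrn.
  by rewrite !natr_Zp subr_eq0.
rewrite inE /= memE; apply: (iffP and3P) => [[_ _ /eqP xy]|[Ux yE]].
  have Ux : (x : 'Z_m.+2) \is a GRing.unit by move: Ua; rewrite -xy unitrM => /andP[].
  by split=> //; rewrite -xy mulrC mulKr.
have gt0 (z : 'Z_m.+2) : z \is a GRing.unit -> (0 < z)%N.
  by case: z => -[|z] zm //; rewrite (_ : Ordinal zm = 0) ?unitr0 //; apply: val_inj.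
split; [exact: gt0 | | by rewrite yE mulrC divrK].
by apply: gt0; rewrite yE unitrM Ua unitrV.
Qed.

Lemma Sbar2E (a : int) (n : nat) : (1 < n)%N -> coprimez n a ->
  Sbar2 a n = hyper_sum a%:~R @: unitsZ n.
Proof.
case: n => [|[|m]] // _ co_a; apply/setP => s; apply/imsetP/imsetP.
  case=> -[x y] /(H2P _ _ co_a)[Ux yE] ->; exists x; rewrite ?inE //.
  by rewrite /hyper_sum -yE intrD -!pmulrn !natr_Zp.
case=> x; rewrite inE => Ux ->; exists (x, a%:~R / x); first exact/H2P.
by rewrite /hyper_sum intrD -!pmulrn !natr_Zp.
Qed.

Lemma Dbar2E (a : int) (n : nat) : (1 < n)%N -> coprimez n a ->
  Dbar2 a n = hyper_sum (- a%:~R) @: unitsZ n.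
Proof.
case: n => [|[|m]] // _ co_a; apply/setP => s; apply/imsetP/imsetP.
  case=> -[x y] /(H2P _ _ co_a)[Ux yE] ->; exists x; rewrite ?inE //.
  by rewrite /hyper_sum mulNr -yE intrB -!pmulrn !natr_Zp.
case=> x; rewrite inE => Ux ->; exists (x, a%:~R / x); first exact/H2P.
by rewrite /hyper_sum mulNr intrB -!pmulrn !natr_Zp.
Qed.

(** * Units and zero divisors modulo a prime power *)

Section PrimePower.

Variables (p t : nat).
Hypotheses (p_prime : prime p) (t_gt0 : (0 < t)%N).

Let n : nat := (p ^ t)%N.
Let n_gt1 : (1 < n)%N. Proof. by rewrite -(exp1n t) ltn_exp2r ?prime_gt1. Qed.
Let p_gt0 : (0 < p)%N. Proof. exact: prime_gt0. Qed.
Let pX_dvd k : (k <= t)%N -> (p ^ k %| n)%N. Proof. exact: dvdn_exp2l. Qed.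
Let p_dvd : (p %| n)%N. Proof. exact: (pX_dvd t_gt0). Qed.

Implicit Types (a b c w x y : 'Z_n).

Lemma unitZpX x : (x \is a GRing.unit) = ~~ (p %| x)%N.
Proof. by rewrite unitZp_coprime // coprime_pexpl // prime_coprime. Qed.

Lemma ZpX_mulr_eq0 i j x y : (i + j = t)%N ->
  (p ^ i %| x)%N -> (p ^ j %| y)%N -> x * y = 0.
Proof.
move=> ijt dx dy; apply/eqP; rewrite Zp_eq0_dvdn // -[X in (X %| _)%N]/(p ^ t)%N.
by rewrite -ijt expnD dvdnZpM // -expnD ijt.
Qed.

(** Valuations of nonzero representatives add up to at least [t]; if that of [x] is at most [i - 1],
    that of [y] is at least [t - i + 1 = j]. *)
Lemma ZpX_mulr_eq0_dvdn i j x y : (i + j = t.+1)%N -> x * y = 0 ->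
  ~~ (p ^ i %| x)%N -> (p ^ j %| y)%N.
Proof.
move=> ijt xy0 ndx.
have : (n %| x * y)%N.
  by rewrite -(dvdn_natZp n_gt1 _ (dvdnn n)) natrM !natr_Zp xy0 -Zp_eq0_dvdn.
have [x0|x_gt0] := posnP x; first by rewrite x0 dvdn0 in ndx.
have [->|y_gt0] := posnP y; first by rewrite dvdn0.
move: ndx; rewrite !pfactor_dvdn ?muln_gt0 ?x_gt0 // lognM //; lia.
Qed.

Lemma card_mult_ZpX k c : (k <= t)%N ->
  #|[set x : 'Z_n | p ^ k %| (x + c)%R]%N| = (p ^ (t - k))%N.
Proof. by move=> kt; rewrite card_Zp_coset ?expn_gt0 ?p_gt0 ?pX_dvd // expnB. Qed.

(** * The equation w (w + c) = 0 and the fibres of [hyper_sum] *)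

Definition quad_roots c : {set 'Z_n} := [set w | w * (w + c) == 0].

(** Since p^(k+1) cannot divide both w and w + c, one of them absorbs p^(t-k). The roots thus form
    two disjoint cosets of the multiples of p^(t-k), each with p^k elements. *)
Lemma card_quad_roots_small k c : (k.*2 < t)%N ->
  (p ^ k %| c)%N -> ~~ (p ^ k.+1 %| c)%N -> #|quad_roots c| = (2 * p ^ k)%N.
Proof.
move=> kt dc ndc.
have dvdS i j x : (i <= j)%N -> (p ^ j %| x)%N -> (p ^ i %| x)%N.
  by move=> ij; apply: dvdn_trans; apply: dvdn_exp2l.
have ndvd w : (p ^ k.+1 %| w)%N -> (p ^ k.+1 %| (w + c)%R)%N = false.
  by move=> dw; rewrite dvdnZpDr ?pX_dvd //; [exact/negbTE | lia].
pose A c' := [set w : 'Z_n | p ^ (t - k) %| (w + c')%R]%N.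
have -> : quad_roots c = A 0 :|: A c.
  apply/setP => w; rewrite !inE addr0; apply/eqP/orP => [wc0|].
    have [//|ndw] := boolP (p ^ (t - k) %| w)%N; [by left | right].
    have dwc : (p ^ k.+1 %| (w + c)%R)%N.
      by apply: ZpX_mulr_eq0_dvdn ndw; first lia.
    rewrite mulrC in wc0; have : ~~ (p ^ k.+1 %| w)%N.
      by apply: contraL dwc => /ndvd ->.
    by apply: contraNT => ndwc; apply: ZpX_mulr_eq0_dvdn ndwc; first lia.
  case=> [dw|dwc].
    apply: (@ZpX_mulr_eq0 (t - k) k) => //; first lia.
    by rewrite dvdnZpD ?pX_dvd //; [lia | apply: dvdS dw; lia].
  apply: (@ZpX_mulr_eq0 k (t - k)) => //; first lia.
  rewrite -[w](addrK c) dvdnZpD ?dvdnZpN ?pX_dvd //; try lia.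
  by apply: dvdS dwc; lia.
rewrite cardsU disjoint_setI0 ?cards0 ?subn0; last first.
  rewrite -setI_eq0; apply/eqP/setP => w; rewrite !inE addr0.
  apply/negP => /andP[dw dwc]; have le : (k.+1 <= t - k)%N by lia.
  by move: (dvdS _ _ _ le dwc); rewrite ndvd // (dvdS _ _ _ le dw).
by rewrite !card_mult_ZpX ?leq_subr // subKn ?addnn ?mul2n //; lia.
Qed.

Lemma card_quad_roots_large c :
  (p ^ uphalf t %| c)%N -> #|quad_roots c| = (p ^ t./2)%N.
Proof.
move=> dc; have tE := odd_double_half t.
have ht : (uphalf t <= t)%N by lia.
have -> : (t./2 = t - uphalf t)%N by lia.
rewrite -(card_mult_ZpX 0 ht); apply: eq_card => w; rewrite !inE addr0.
apply/eqP/idP => [wc0|dw].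
  apply: contraT => ndw; case/negP: (ndw).
  (* The exponent is at least [uphalf t], so [p ^ uphalf t] divides both w + c and c, hence w. *)
  have dwc : (p ^ (t.+1 - uphalf t) %| (w + c)%R)%N.
    by apply: ZpX_mulr_eq0_dvdn ndw; first lia.
  rewrite -(dvdnZpDr n_gt1 _ _ dc) ?pX_dvd // addrC; apply: dvdn_trans dwc.
  by apply: dvdn_exp2l; lia.
apply: (@ZpX_mulr_eq0 (uphalf t) (t - uphalf t)) => //; first lia.
apply: (@dvdn_trans (p ^ uphalf t)); first by apply: dvdn_exp2l; lia.
by rewrite dvdnZpD ?pX_dvd.
Qed.

(** Multiplying the difference of the two values by y gives (y - x) (y - a/x), which is w (w + c)
    for w = y - x. *)
Lemma hyper_sum_fibre a x : x \is a GRing.unit -> a \is a GRing.unit ->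
  #|[set y in unitsZ n | hyper_sum a y == hyper_sum a x]|
    = #|quad_roots (x - a / x)|.
Proof.
move=> Ux Ua; set c := x - a / x.
rewrite -[RHS](card_preimset (f := fun y => y - x) _ (@addIr _ (- x))).
apply: eq_card => y; rewrite !inE.
have -> : y - x + c = y - a / x by rewrite /c; ring.
have key : y \is a GRing.unit ->
    y * (hyper_sum a y - hyper_sum a x) = (y - x) * (y - a / x).
  move=> Uy; rewrite /hyper_sum.
  have [Ey Ex] : y * (a / y) = a /\ x * (a / x) = a by rewrite !mulrA !(mulrC _ a) !mulrK.
  transitivity (y * (a / y) + (y * y - y * x - y * (a / x))); first by ring.
  by rewrite Ey -{1}Ex; ring.
apply/andP/eqP => [[Uy /eqP Exy]|yx0]; first by rewrite -key // Exy subrr mulr0.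
(* If p divided y, then y - x would be a unit, forcing y = a/x, which is a unit. *)
have Uy : y \is a GRing.unit.
  rewrite unitZpX; apply/negP => dy.
  have Uyx : y - x \is a GRing.unit.
    by rewrite unitZpX dvdnZpDr // dvdnZpN // -unitZpX.
  have yax : y - a / x = 0 by rewrite -[LHS](mulKr Uyx) yx0 mulr0.
  have : y \is a GRing.unit by rewrite (subr0_eq yax) unitrM Ua unitrV.
  by rewrite unitZpX dy.
by split=> //; rewrite -subr_eq0; apply/eqP/(mulrI Uy); rewrite key // yx0 mulr0.
Qed.

(** The largest k with 2k < t, that is, the last valuation at which there are two separate cosets of
    roots. *)
Let h : nat := t.-1./2.
Let hE : uphalf t = h.+1. Proof. by rewrite /h; lia. Qed.
Let q : rat := p%:R^-1.

(* The inverse fibre size, written as an Abel sum over the powers of p dividing c. *)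
Lemma inv_card_quad_roots c :
  #|quad_roots c|%:R^-1 = 2^-1
    + \sum_(i < h) (p ^ i.+1 %| c)%N%:R * ((q ^+ i.+1 - q ^+ i) / 2)
    + (p ^ h.+1 %| c)%N%:R * (q ^+ t./2 - q ^+ h / 2) :> rat.
Proof.
(* Here every indicator is 1: the sum telescopes to (q^h - 1)/2 and the last term corrects the total
   to q^(t/2), with t/2 rounded down. *)
have [dc|ndc] := boolP (p ^ h.+1 %| c)%N.
  rewrite card_quad_roots_large ?hE // mul1r natrX -exprVn -/q.
  rewrite (eq_bigr (fun i : 'I_h => (q ^+ i.+1 - q ^+ i) / 2)) => [|i _]; last first.
    by rewrite (dvdn_trans _ dc) ?mul1r // dvdn_exp2l // ltnS ltnW.
  by rewrite sumr_geom_telescope; field.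
(* Otherwise the indicators stop at the valuation k of c, with k <= h, leaving q^k / 2. Zero is set
   aside because [logn p 0] is 0. *)
have [c0|c_gt0] := posnP c; first by rewrite c0 dvdn0 in ndc.
have dvdE i : (p ^ i %| c)%N = (i <= logn p c)%N by rewrite pfactor_dvdn.
set k := logn p c in dvdE; rewrite dvdE -ltnNge ltnS in ndc.
rewrite (@card_quad_roots_small k) ?dvdE ?ltnn //; last by rewrite /h in ndc; lia.
under eq_bigr do rewrite dvdE.
rewrite (@sumr_indicator_lt _ k h (fun i => (q ^+ i.+1 - q ^+ i) / 2)) // sumr_geom_telescope.
by rewrite natrM natrX invfM -exprVn -/q mul0r; field.
Qed.

(** * Image sizes from the counts of units x with p^k dividing x - a/x *)

Lemma card_units_ZpX : #|unitsZ n| = totient n.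
Proof.
have -> : unitsZ n = ~: [set x : 'Z_n | p ^ 1 %| (x + 0)%R]%N.
  by apply/setP => x; rewrite !inE addr0 unitZpX.
rewrite cardsCs setCK card_mult_ZpX // card_ord Zp_cast // totient_pfactor //.
rewrite -[X in (X - _)%N]/(p ^ t)%N -{1}(subnK t_gt0) addn1 expnS -subn1 mulnBl mul1n.
by rewrite subn1.
Qed.

(** Summing the expansion of the inverse fibre sizes over all units and exchanging the sums turns
    the indicators into counts. *)
Lemma card_hyper_sum a : a \is a GRing.unit ->
  #|hyper_sum a @: unitsZ n|%:R = (totient n)%:R / 2
    + \sum_(i < h) #|[set x in unitsZ n | (p ^ i.+1 %| (x - a / x)%R)%N]|%:R
         * ((q ^+ i.+1 - q ^+ i) / 2)
    + #|[set x in unitsZ n | (p ^ h.+1 %| (x - a / x)%R)%N]|%:R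
         * (q ^+ t./2 - q ^+ h / 2) :> rat.
Proof.
move=> Ua; rewrite card_imset_fibre.
have cardE k : #|[set x in unitsZ n | (p ^ k %| (x - a / x)%R)%N]|%:R
    = \sum_(x in unitsZ n) (p ^ k %| (x - a / x)%R)%N%:R :> rat.
  rewrite -sum1_card natr_sum big_mkcond [RHS]big_mkcond; apply: eq_bigr => x _.
  by rewrite !inE; case: (x \is a _) => //; case: (_ %| _)%N.
under eq_bigr => x /[!inE] Ux do rewrite hyper_sum_fibre // inv_card_quad_roots.
rewrite !big_split sumr_const exchange_big cardE mulr_suml; congr (_ + _ + _).
  by rewrite card_units_ZpX mulr_natl.
by apply: eq_bigr => i _; rewrite cardE mulr_suml.
Qed.

(** * Odd [p]: the image size when the parameter is a square *)

Hypothesis p_odd : odd p.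

Let two_unit : (2 : 'Z_n) \is a GRing.unit.
Proof.
rewrite unitZpX (dvdn_natZp n_gt1 2 p_dvd) (dvdn_prime2 p_prime) //.
by apply: contraL p_odd => /eqP ->.
Qed.

(** In x (x - b^2/x) = (x - b) (x + b) the two factors differ by the unit 2b, so [p] divides at most
    one of them, and p^k must divide that one alone. *)
Lemma card_sqr_near_roots b k : b \is a GRing.unit -> (0 < k <= t)%N ->
  #|[set x in unitsZ n | (p ^ k %| (x - b ^+ 2 / x)%R)%N]| = (2 * p ^ (t - k))%N.
Proof.
move=> Ub /andP[k_gt0 kt].
have dvd_p x : (p ^ k %| x)%N -> (p %| x)%N.
  by apply: dvdn_trans; rewrite -{1}(expn1 p) dvdn_exp2l.
have U2b c : c ^+ 2 = b ^+ 2 -> c *+ 2 \is a GRing.unit.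
  by move=> cb; rewrite -mulr_natr unitrM two_unit -(unitrX_pos _ (isT : (0 < 2)%N)) cb unitrX.
have unit_near c x : c ^+ 2 = b ^+ 2 -> (p %| (x + c)%R)%N -> x - c \is a GRing.unit.
  move=> /U2b U2c dxc; rewrite unitZpX (_ : x - c = (x + c) - c *+ 2); last by ring.
  by rewrite dvdnZpDr // dvdnZpN // -unitZpX.
pose A c := [set x : 'Z_n | p ^ k %| (x + c)%R]%N.
have -> : [set x in unitsZ n | (p ^ k %| (x - b ^+ 2 / x)%R)%N] = A b :|: A (- b).
  apply/setP => x; rewrite !inE.
  have xE : x \is a GRing.unit -> x * (x - b ^+ 2 / x) = (x + b) * (x - b).
    by move=> Ux; rewrite mulrBr mulrCA divrr // mulr1; ring.
  apply/andP/orP => [[Ux]|].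
    rewrite -(dvdnZpMunit n_gt1 _ _ Ux) ?pX_dvd // xE //.
    have [dxb|] := boolP (p %| (x + b)%R)%N.
      by rewrite mulrC dvdnZpMunit ?pX_dvd //; [left | exact: unit_near].
    by rewrite -unitZpX => Uxb; rewrite dvdnZpMunit ?pX_dvd //; right.
  move=> dx.
  have Ux : x \is a GRing.unit.
    rewrite unitZpX; apply/negP => px; move: Ub; rewrite unitZpX => /negP; apply.
    by case: dx => /dvd_p; rewrite dvdnZpDr ?dvdnZpN.
  split=> //; rewrite -(dvdnZpMunit n_gt1 _ _ Ux) ?pX_dvd // xE //.
  by case: dx => dx; last rewrite mulrC; rewrite mulrC dvdnZpMl ?pX_dvd.
rewrite cardsU disjoint_setI0 ?cards0 ?subn0; last first.
  rewrite -setI_eq0; apply/eqP/setP => x; rewrite !inE.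
  apply/negP => /andP[/dvd_p dx /dvd_p]; apply/negP.
  by rewrite -unitZpX unit_near.
by rewrite !card_mult_ZpX // addnn mul2n.
Qed.

Let P_neq0 : p%:R != 0 :> rat. Proof. by rewrite pnatr_eq0 -lt0n. Qed.

Let totient_ratE : (totient n)%:R = (p%:R - 1) * p%:R ^+ t.-1 :> rat.
Proof. by rewrite totient_pfactor // natrM natrX -subn1 natrB. Qed.

Lemma card_hyper_sum_sqr b : b \is a GRing.unit ->
  #|hyper_sum (b ^+ 2) @: unitsZ n|%:R =
    (totient n)%:R * (2^-1 - \sum_(i < t./2) q ^+ (2 * i + 1)) + 1 :> rat.
Proof.
move=> Ub; rewrite card_hyper_sum ?unitrX //.
have ht : (0 < h.+1 <= t)%N by rewrite /h; lia.
rewrite card_sqr_near_roots // (_ : t - h.+1 = t./2)%N; last by rewrite /h; lia.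
rewrite (eq_bigr (fun i : 'I_h => - (totient n)%:R * q ^+ (2 * i + 1))); last first.
  move=> i _; have it : (i.+1 <= t)%N by have := ltn_ord i; rewrite /h; lia.
  rewrite card_sqr_near_roots // totient_ratE natrM natrX.
  have -> : (t.-1 = (t - i.+1) + i)%N by lia.
  rewrite addn1 mul2n -addnn !exprD !exprS exprD /q !exprVn; field.
  by rewrite P_neq0 expf_neq0.
rewrite -mulr_sumr natrM natrX.
have qP k : p%:R ^+ k * q ^+ k = 1 :> rat by rewrite -exprMn mulfV ?expr1n.
(* The boundary term is 1 for odd [t]. For even [t] it is 2 - p = 1 - (p - 1), and -(p - 1) supplies
   the missing summand at index [h], since [t.-1] is 2h + 1. *)
have := odd_double_half t; case t_odd: (odd t) => tE.
  have -> : t./2 = h by rewrite /h; lia.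
  transitivity ((totient n)%:R * (2^-1 - \sum_(i < h) q ^+ (2 * i + 1))
     + 2 * (p%:R ^+ h * q ^+ h) - p%:R ^+ h * q ^+ h); first by field.
  by rewrite qP; field.
have -> : t./2 = h.+1 by rewrite /h; lia.
rewrite big_ord_recr totient_ratE (_ : t.-1 = (2 * h + 1)%N); last by rewrite /h; lia.
rewrite !exprS; set S := \sum_(i < h) _.
transitivity ((p%:R - 1) * p%:R ^+ (2 * h + 1) * (2^-1 - S)
   + 2 * (p%:R * q) * (p%:R ^+ h * q ^+ h) - p%:R * (p%:R ^+ h * q ^+ h)).
  by rewrite /S /=; field.
transitivity ((p%:R - 1) * p%:R ^+ (2 * h + 1) * (2^-1 - S)
   - (p%:R - 1) * (p%:R ^+ (2 * h + 1) * q ^+ (2 * h + 1)) + 1).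
  by rewrite !qP /q mulfV //; ring.
by rewrite /S /=; ring.
Qed.

(** * Totient twice an odd number: square roots, and -1 as a non-square *)

Variable m : nat.
Hypotheses (m_odd : odd m) (totE : totient n = m.*2).

(* e = a^m satisfies e^2 = 1 and e = 1 mod p, hence e = 1 as e + 1 is a unit; so
   a^((m+1)/2) is a square root of a. *)
Lemma ZpX_sqrt_lift a c : a \is a GRing.unit -> (p %| (c ^+ 2 - a)%R)%N ->
  exists2 b, b \is a GRing.unit & b ^+ 2 = a.
Proof.
move=> Ua dca.
have Uc : c \is a GRing.unit.
  rewrite -(unitrX_pos _ (isT : (0 < 2)%N)) unitZpX.
  by rewrite -(subrK a (c ^+ 2)) dvdnZpDr // -unitZpX.
have cm1 : (c ^+ 2) ^+ m = 1 by rewrite -exprM mul2n -totE unitZp_expr_totient.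
have de : (p %| (a ^+ m - 1)%R)%N.
  by rewrite -cm1 -opprB dvdnZpN // subrXX mulrC dvdnZpMl.
have Ue : a ^+ m + 1 \is a GRing.unit.
  rewrite (_ : a ^+ m + 1 = (a ^+ m - 1) + 2); last by ring.
  by rewrite unitZpX dvdnZpDr // -unitZpX.
have am1 : a ^+ m = 1.
  apply/eqP; rewrite -subr_eq0; apply/eqP/(mulIr Ue); rewrite mul0r -subr_sqr expr1n.
  by rewrite -exprM muln2 -totE unitZp_expr_totient ?subrr.
exists (a ^+ (m.+1)./2); first exact: unitrX.
rewrite -exprM muln2 (_ : (m.+1)./2.*2 = m.+1) ?exprS ?am1 ?mulr1 //.
by rewrite -[RHS]odd_double_half /= m_odd.
Qed.

(** If [p] divided x^2 + b^2, raising x^2 = -b^2 mod [p] to the odd power [m] would give 1 = -1 mod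
    [p]. *)
Lemma unit_sqrDsqr b x : b \is a GRing.unit -> x \is a GRing.unit ->
  x ^+ 2 + b ^+ 2 \is a GRing.unit.
Proof.
move=> Ub Ux; rewrite unitZpX; apply/negP => d.
have xm1 y : y \is a GRing.unit -> (y ^+ 2) ^+ m = 1.
  by move=> Uy; rewrite -exprM mul2n -totE unitZp_expr_totient.
move: two_unit; rewrite unitZpX => /negP; apply.
have -> : 2 = (x ^+ 2) ^+ m - (- b ^+ 2) ^+ m :> 'Z_n.
  by rewrite exprNn -signr_odd m_odd !xm1 // expr1 mulr1 opprK.
by rewrite subrXX opprK mulrC dvdnZpMl.
Qed.

(** Here x - a/x becomes (x^2 + b^2)/x, a unit, so every divisibility count vanishes and only the
    leading term remains. *)
Lemma card_hyper_sum_opp_sqr b : b \is a GRing.unit ->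
  #|hyper_sum (- b ^+ 2) @: unitsZ n|%:R = (totient n)%:R / 2 :> rat.
Proof.
move=> Ub; have card0 k :
    #|[set x in unitsZ n | (p ^ k.+1 %| (x - - b ^+ 2 / x)%R)%N]| = 0%N.
  apply/eqP; rewrite cards_eq0; apply/eqP/setP => x; rewrite !inE.
  apply/negP => /andP[Ux dx].
  have := unit_sqrDsqr Ub Ux; rewrite unitZpX => /negP; apply.
  have -> : x ^+ 2 + b ^+ 2 = x * (x - - b ^+ 2 / x).
    by rewrite mulNr opprK mulrDr mulrCA divrr ?mulr1.
  by rewrite dvdnZpMl // (dvdn_trans _ dx) // expnS dvdn_mulr.
rewrite card_hyper_sum ?unitrN ?unitrX // card0 mul0r addr0 big1 ?addr0 // => i _.
by rewrite card0 mul0r.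
Qed.

End PrimePower.

Theorem theorem3p8 (p t : nat) (a : int)
    (p_prime : prime p) (p_mod4 : p = 3 %[mod 4])
    (t_ge1 : (1 <= t)%N)
    (p_ndvd_a : ~~ (p%:Z %| a)%Z)
    (a_legendre : legendre a p = 1) :
  c2 a (p ^ t) =
    1 - 2 * (\sum_(i < t./2) 1 / p%:R ^+ (2 * i + 1)) + 2 / (totient (p ^ t))%:R.
Proof.
have n_gt1 : (1 < p ^ t)%N by rewrite -(exp1n t) ltn_exp2r ?prime_gt1.
have p_dvd : (p %| p ^ t)%N by rewrite -{1}(expn1 p) dvdn_exp2l.
have p_odd : odd p by lia.
have co_a : coprimez (p ^ t)%N a.
  by rewrite coprimezE /= coprime_pexpl // prime_coprime.
(* Half the totient; (p - 1)/2 is odd because [p] is 3 modulo 4. *)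
pose m := (p.-1./2 * p ^ t.-1)%N.
have m_odd : odd m by rewrite oddM oddX p_odd orbT andbT; lia.
have totE : totient (p ^ t) = m.*2.
  by rewrite totient_pfactor // -muln2 mulnAC muln2; congr (_ * _)%N; lia.
(* The Legendre symbol gives a square root modulo [p] only; [ZpX_sqrt_lift] then makes it exact
   modulo [p ^ t]. *)
have [c dca] : exists c : 'Z_(p ^ t), (p %| (c ^+ 2 - a%:~R)%R)%N.
  move: a_legendre; rewrite /legendre (negbTE p_ndvd_a).
  case: existsP => // -[x xa] _; exists (x : nat)%:R.
  rewrite expr2 -natrM pmulrn PoszM -intrB dvdn_intZp // -expr2.
  by rewrite -eqz_mod_dvd.
have Ua : (a%:~R : 'Z_(p ^ t)) \is a GRing.unit.
  by rewrite unitZpX // dvdn_intZp.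
have [b Ub bE] := ZpX_sqrt_lift p_prime t_ge1 p_odd m_odd totE Ua dca.
rewrite /c2 Sbar2E // Dbar2E // -bE.
rewrite (card_hyper_sum_opp_sqr _ _ _ m_odd) // card_hyper_sum_sqr //.
have : (totient (p ^ t))%:R != 0 :> rat.
  by rewrite pnatr_eq0 -lt0n totient_gt0 expn_gt0 prime_gt0.
under [in RHS]eq_bigr do rewrite div1r -exprVn.
by set F := _%:R; set S := \sum_(i < _) _ => F0; field.
Qed.
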